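(* Let $H,\alpha_\ell,\alpha_g,\tau,b>0$ and let $\rho\in\mathcal U=\{\rho\in\mathbb R: 0\le\rho<\tau\}$. Suppose $\hat b=b$ and let the inverter transfer function be $G_{\omega_{\rm vsi},p_{\rm vsi}}(s)=k_p+\frac{k_i}{s}+k_d s$ with $$k_d=\frac{\tau\rho}{\alpha_g(\tau-\rho)}-\frac1{\hat b},\qquad k_p=\frac{\tau+\rho}{\alpha_g(\tau-\rho)},\qquad k_i=\frac1{\alpha_g(\tau-\rho)}.$$ Then: (i) the transfer function $G_{p_{\rm vsi},\omega_{\rm sm}}(s)$ is stable; (ii) the closed-loop transfer function from $-p_\ell$ to $\omega_{\rm sm}$, that is, $-G^{\rm cl}_{\omega_{\rm sm},p_\ell}(s)$, is passive; (iii) $-G_{\omega_{\rm vsi},p_{\rm vsi}}(s)$ is minimum phase if and only if $\rho\in\mathcal N$, where $$\mathcal N=\Big\{\rho\in\mathbb R:\ \frac{\alpha_g\tau}{\hat b\,\tau+\alpha_g}\le\rho<\tau\Big\}.$$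
   Context: Two-bus power system model. A synchronous machine with inertia constant $H>0$, load frequency sensitivity $\alpha_\ell>0$, governor gain $\alpha_g>0$ and turbine time constant $\tau>0$ has frequency deviation $\omega_{\rm sm}=-G_{\omega_{\rm sm},p_{\rm sm}}(s)\,p_{\rm sm}$, where $$G_{\omega_{\rm sm},p_{\rm sm}}(s)=\frac{1}{2Hs+\alpha_\ell+\frac{\alpha_g}{\tau s+1}}.$$ An inverter with dynamics $\omega_{\rm vsi}=-G_{\omega_{\rm vsi},p_{\rm vsi}}(s)\,p_{\rm vsi}$ is connected to it through a lossless line of susceptance $b>0$, so $p_{\rm vsi}=\frac{b}{s}(\omega_{\rm vsi}-\omega_{\rm sm})$. The power balance is $p_{\rm sm}=p_\ell-p_{\rm vsi}$, where $p_\ell$ is the load perturbation. Consequently $p_{\rm vsi}=G_{p_{\rm vsi},\omega_{\rm sm}}(s)\,\omega_{\rm sm}$ and $\omega_{\rm sm}=G^{\rm cl}_{\omega_{\rm sm},p_\ell}(s)\,p_\ell$ with $$G_{p_{\rm vsi},\omega_{\rm sm}}(s)=-\frac{1}{\frac1b s+G_{\omega_{\rm vsi},p_{\rm vsi}}(s)},\qquad G^{\rm cl}_{\omega_{\rm sm},p_\ell}(s)=-\frac{\big(\frac1b s+G_{\omega_{\rm vsi},p_{\rm vsi}}(s)\big)G_{\omega_{\rm sm},p_{\rm sm}}(s)}{\frac1b s+G_{\omega_{\rm sm},p_{\rm sm}}(s)+G_{\omega_{\rm vsi},p_{\rm vsi}}(s)}.$$ The parameter $\hat b>0$ is the estimate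 of $b$ used in the controller, and $\rho$ is the desired effective turbine time constant. Conventions. All transfer functions are real rational functions of $s$, taken in reduced form. A transfer function is stable if all its poles have strictly negative real part. It is passive if it is positive real, i.e. analytic in $\operatorname{Re}s>0$ with nonnegative real part there. It is minimum phase if all its (finite) zeros have strictly negative real part. *)

(* Defs.v *)
From HB Require Import structures.
From mathcomp Require Import all_boot all_order all_algebra.
From mathcomp Require Import generic_quotient fraction complex.
From mathcomp Require Import all_classical all_reals all_analysis.
Set Implicit Arguments.
Unset Strict Implicit.
Unset Printing Implicit Defensive.
Import Order.TTheory GRing.Theory Num.Theory.
Import numFieldNormedType.Exports.
Local Open Scope classical_set_scope.
Local Open Scope quotient_scope.
Local Open Scope ring_scope.

(* A transfer function is an element of the
   field R(s), with R : realType; poles, zeros and values are taken in R[i]. *)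
Notation tf R := {fraction {poly R}}.

Section TransferFunctions.
Variable R : realType.
Implicit Types (G : tf R) (p : {poly R}) (z : R[i]).

Definition tfC (c : R) : tf R := tofrac c%:P.
Definition tfs : tf R := tofrac 'X.

(* A representative of a fraction need not be coprime, so the gcd is divided
   out; tf_reduced shows that the result is the reduced form, which is unique
   up to a common nonzero constant. *)
Definition tfnum G : {poly R} :=
  let: (p, q) := frac (repr G) in p %/ gcdp p q.
Definition tfden G : {poly R} :=
  let: (p, q) := frac (repr G) in q %/ gcdp p q.

Lemma tfden_neq0 G : tfden G != 0.
Proof.
have := denom_ratioP (repr G); rewrite /tfden.
case: (frac (repr G)) => p q /= q0.
by apply: contraNneq q0 => e; rewrite -(divpK (dvdp_gcdr p q)) e mul0r.
Qed.

Lemma tf_reduced G :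
  G = tofrac (tfnum G) / tofrac (tfden G) /\ coprimep (tfnum G) (tfden G).
Proof.
have := tfden_neq0 G.
have : G * tofrac (frac (repr G)).2 = tofrac (frac (repr G)).1.
  rewrite -[X in X * _]reprK /FracField.tofrac -!lock.
  rewrite -[LHS]/(FracField.mul _ _) -FracField.pi_mul.
  apply/eqmodP; rewrite /= FracField.equivfE /FracField.mulf.
  by rewrite !numden_Ratio ?mulf_neq0 ?oner_neq0 ?denom_ratioP// !mulr1 mulrC.
have := denom_ratioP (repr G); rewrite /tfnum /tfden.
case: (frac (repr G)) => p q /= q0 Gq d0.
split; last by apply: coprimep_div_gcd; rewrite q0 orbT.
apply: (mulIf (x := tofrac q)); first by rewrite tofrac_eq0.
rewrite Gq -[in tofrac q](divpK (dvdp_gcdr p q)).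
rewrite -[in LHS](divpK (dvdp_gcdl p q)).
by rewrite !tofracM mulrA divfK// tofrac_eq0.
Qed.

Definition to_complex p : {poly R[i]} := map_poly (real_complex R) p.

Definition is_pole G z : Prop := root (to_complex (tfden G)) z.
Definition is_zero G z : Prop := root (to_complex (tfnum G)) z.

(* Meaningful only away from the poles, where division by 0 returns 0. *)
Definition tfeval G z : R[i] :=
  (to_complex (tfnum G)).[z] / (to_complex (tfden G)).[z].

(* Complex differentiability: R[i]^o is R[i] as a normed space over R[i], so
   the increment in direction 1 ranges over all complex numbers. *)
Definition complex_derivable (f : R[i] -> R[i]) z : Prop :=
  derivable (f : R[i]^o -> R[i]^o) (z : R[i]^o) (1 : R[i]^o).

Definition stable G : Prop :=
  forall z, is_pole G z -> complex.Re z < 0.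

Definition minimum_phase G : Prop :=
  forall z, is_zero G z -> complex.Re z < 0.

(* Positive realness; the coefficients of G are real by typing. *)
Definition passive G : Prop :=
  forall z, 0 < complex.Re z ->
    [/\ ~ is_pole G z, complex_derivable (tfeval G) z
      & 0 <= complex.Re (tfeval G z)].

Definition G_sm (H alpha_l alpha_g tau : R) : tf R :=
  1 / (tfC (2 * H) * tfs + tfC alpha_l + tfC alpha_g / (tfC tau * tfs + 1)).

(* Sign convention: omega_vsi = - G_vsi * p_vsi. *)
Definition G_vsi (kp ki kd : R) : tf R :=
  tfC kp + tfC ki / tfs + tfC kd * tfs.

(* p_vsi = G_pvsi * omega_sm *)
Definition G_pvsi (b : R) (Gvsi : tf R) : tf R :=
  - (1 / (tfC (1 / b) * tfs + Gvsi)).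

(* omega_sm = G_cl * p_l *)
Definition G_cl (b : R) (Gsm Gvsi : tf R) : tf R :=
  - ((tfC (1 / b) * tfs + Gvsi) * Gsm / (tfC (1 / b) * tfs + Gsm + Gvsi)).

Definition setU_rho (tau : R) : set R := [set rho | 0 <= rho < tau].

Definition setN_rho (alpha_g tau bhat : R) : set R :=
  [set rho | alpha_g * tau / (bhat * tau + alpha_g) <= rho < tau].

End TransferFunctions.

(* Main.v *)
(* Put c = alpha_g (tau - rho). With bhat = b the gains make the line and the
   inverter together equal to s/b + G_vsi = (tau s + 1)(rho s + 1) / (c s), whence
   (i). Since
     alpha_g / (tau s + 1) + c s / ((tau s + 1)(rho s + 1)) = alpha_g / (rho s + 1),
   the closed loop -G_cl = 1 / (1 / G_sm + 1 / (s/b + G_vsi)) is the machine itself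
   with tau replaced by rho, 1 / (2 H s + alpha_l + alpha_g / (rho s + 1)), and
   sums and inverses preserve a positive real part. The zeros in (iii) are the
   roots of kd s^2 + kp s + ki with kp, ki > 0, all in the open left half-plane
   iff kd >= 0, which is the condition rho \in N. *)
Require Import Defs.
From mathcomp Require Import all_boot all_order all_algebra.
From mathcomp Require Import complex ring lra.
From mathcomp Require Import all_classical all_reals all_analysis.
Import Order.TTheory GRing.Theory Num.Theory.
Local Open Scope classical_set_scope.
Local Open Scope ring_scope.

(** Stated over any [numFieldType] so that it applies to [R[i]], where it gives complex
    differentiability. *)
Lemma derivable_horner_num {K : numFieldType} (p : {poly K}) (x : K^o) :
  derivable (horner p : K^o -> K^o) x 1.
Proof.
elim/poly_ind: p => [|p c ih].
  have -> : horner (0 : {poly K}) = cst 0 by apply/funext => y; rewrite horner0.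
  exact: derivable_cst.
have -> : horner (p * 'X + c%:P) =
    ((horner p : K^o -> K^o) * id + cst c : K^o -> K^o).
  by apply/funext => y; rewrite hornerMXaddC.
apply: derivableD; last exact: derivable_cst.
by apply: derivableM => //; exact: derivable_id.
Qed.

(** * Reduced form versus an arbitrary fraction [p / q] *)

Section ReducedFractions.
Context {R : realType}.
Implicit Types (G : tf R) (p q : {poly R}) (z : R[i]).

Lemma tf_cross {G p q} : q != 0 -> G = tofrac p / tofrac q ->
  p * tfden G = tfnum G * q.
Proof.
move=> q0 Gpq; have [Gnd _] := tf_reduced G.
have d0 : tofrac (tfden G) != 0 by rewrite tofrac_eq0 tfden_neq0.
have fq0 : tofrac q != 0 by rewrite tofrac_eq0.
have ep : tofrac p = G * tofrac q by rewrite Gpq (divfK fq0).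
have en : tofrac (tfnum G) = G * tofrac (tfden G).
  by rewrite [X in X * _]Gnd (divfK d0).
apply/eqP; rewrite -tofrac_eq; apply/eqP.
by rewrite (tofracM p) (tofracM (tfnum G)) ep en mulrAC.
Qed.

(** Gauss: [tfden G] divides [tfnum G * q] and is coprime to [tfnum G]. Hence poles can be sought
    among the roots of any denominator. *)
Lemma tfden_dvdp {G p q} : q != 0 -> G = tofrac p / tofrac q -> tfden G %| q.
Proof.
move=> q0 Gpq; have [_ cop] := tf_reduced G.
rewrite coprimep_sym in cop.
by rewrite -(Gauss_dvdpr q cop) -(tf_cross q0 Gpq) dvdp_mull.
Qed.

Lemma tfnum_dvdp {G p q} : q != 0 -> G = tofrac p / tofrac q -> tfnum G %| p.
Proof.
move=> q0 Gpq; have [_ cop] := tf_reduced G.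
by rewrite -(Gauss_dvdpl p cop) (tf_cross q0 Gpq) dvdp_mulr.
Qed.

(** Coprimality ensures that no factor of [p] cancels against [q], so that roots of [p] are genuine
    zeros. *)
Lemma dvdp_tfnum {G p q} : q != 0 -> coprimep p q ->
  G = tofrac p / tofrac q -> p %| tfnum G.
Proof.
move=> q0 cop Gpq.
by rewrite -(Gauss_dvdpl (tfnum G) cop) -(tf_cross q0 Gpq) dvdp_mulr.
Qed.

Lemma root_to_complex_dvdp {p q} z :
  p %| q -> root (to_complex p) z -> root (to_complex q) z.
Proof.
rewrite -(dvdp_map (real_complex R)) => pq.
by rewrite !root_factor_theorem => /dvdp_trans ->.
Qed.

Lemma is_pole_root {G p q z} : q != 0 -> G = tofrac p / tofrac q ->
  is_pole G z -> root (to_complex q) z.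
Proof. by move=> q0 /(tfden_dvdp q0); exact: root_to_complex_dvdp. Qed.

Lemma is_zero_root {G p q z} : q != 0 -> G = tofrac p / tofrac q ->
  is_zero G z -> root (to_complex p) z.
Proof. by move=> q0 /(tfnum_dvdp q0); exact: root_to_complex_dvdp. Qed.

Lemma root_is_zero {G p q z} : q != 0 -> coprimep p q ->
  G = tofrac p / tofrac q -> root (to_complex p) z -> is_zero G z.
Proof. by move=> q0 cop /(dvdp_tfnum q0 cop); exact: root_to_complex_dvdp. Qed.

Lemma tfevalE {G p q z} : q != 0 -> G = tofrac p / tofrac q ->
  (to_complex q).[z] != 0 ->
  tfeval G z = (to_complex p).[z] / (to_complex q).[z].
Proof.
move=> q0 Gpq qz; have dz : (to_complex (tfden G)).[z] != 0.
  by apply: contra qz; exact: (is_pole_root q0 Gpq).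
apply/eqP; rewrite /tfeval eqr_div // -!hornerM -!rmorphM /=.
by rewrite (tf_cross q0 Gpq).
Qed.

Lemma tfeval_derivable G z : ~ is_pole G z -> complex_derivable (tfeval G) z.
Proof.
move=> /negP npole; rewrite /complex_derivable /tfeval.
apply: (@derivableM _ _ (horner (to_complex (tfnum G)) : _^o -> _^o)
  (fun y : _^o => (to_complex (tfden G)).[y]^-1 : _^o)).
  exact: derivable_horner_num.
apply: (@derivableV _ _ (horner (to_complex (tfden G)) : _^o -> _^o)) => //.
exact: derivable_horner_num.
Qed.

End ReducedFractions.

(** * Real parts of sums and inverses *)

Section ComplexRealPart.
Context {R : realType}.
Implicit Types z w : R[i].
Local Notation Re := (@complex.Re R).

Lemma ReMl (x : R) z : Re (x%:C%C * z) = x * Re z.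
Proof. by case: z => u v /=; rewrite mul0r subr0. Qed.

Lemma ReC (x : R) : Re x%:C%C = x.
Proof. by []. Qed.

Lemma ReD z w : Re (z + w) = Re z + Re w.
Proof. exact: raddfD. Qed.

Lemma ReV z : Re z^-1 = Re z / (Re z ^+ 2 + complex.Im z ^+ 2).
Proof. by case: z. Qed.

Lemma ReV_ge0 z : 0 <= Re z -> 0 <= Re z^-1.
Proof. by move=> z0; rewrite ReV divr_ge0 // addr_ge0 // sqr_ge0. Qed.

Lemma Re_neq0 z : Re z != 0 -> z != 0.
Proof. by apply: contraNneq => ->. Qed.

Lemma Re_affine_gt0 {x y : R} {z} : 0 <= x -> 0 < y -> 0 <= Re z ->
  0 < Re (x%:C%C * z + y%:C%C).
Proof. by move=> x0 y0 z0; rewrite ReD ReMl ReC ltr_wpDl // mulr_ge0. Qed.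

End ComplexRealPart.

(** Either coefficient may vanish: [rho = 0] and [kd = 0] need no separate treatment, and
    [affine c 0] encodes c s. *)
Definition affine {R : realType} (a b : R) : {poly R} := a%:P * 'X + b%:P.

Section PowerSystem.
Context {R : realType}.
Implicit Types (a b c x y H al ag tau rho kp ki kd : R) (z : R[i]).

Lemma affine_neq0 a b : b != 0 -> affine a b != 0.
Proof.
by apply: contraNneq => /(congr1 (horner^~ 0)); rewrite /affine !hornerE => ->.
Qed.

Lemma to_complex_affine a b z :
  (to_complex (affine a b)).[z] = a%:C%C * z + b%:C%C.
Proof.
by rewrite /to_complex /affine rmorphD rmorphM /= !map_polyC map_polyX !hornerE.
Qed.

(** * Transfer functions as explicit fractions *)

Lemma tfC1 : tfC 1 = 1 :> tf R.
Proof. by rewrite /tfC polyC1 tofrac1. Qed.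

Lemma tfCD : {morph @tfC R : x y / x + y}.
Proof. by move=> x y; rewrite /tfC polyCD tofracD. Qed.

Lemma tfCN : {morph @tfC R : x / - x}.
Proof. by move=> x; rewrite /tfC polyCN tofracN. Qed.

Lemma tfCM : {morph @tfC R : x y / x * y}.
Proof. by move=> x y; rewrite /tfC polyCM tofracM. Qed.

Lemma tfC_eq0 x : (tfC x == 0) = (x == 0).
Proof. by rewrite /tfC tofrac_eq0 polyC_eq0. Qed.

Lemma tfCV : {morph @tfC R : x / x^-1}.
Proof.
(* At 0 both inverses take the default value 0. *)
move=> x; have [->|x0] := eqVneq x 0; first by rewrite invr0 /tfC tofrac0 invr0.
have fx0 : tfC x != 0 by rewrite tfC_eq0.
by apply: (mulfI fx0); rewrite -tfCM (mulfV fx0) (mulfV x0) tfC1.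
Qed.

Lemma tfs_neq0 : tfs R != 0.
Proof. by rewrite /tfs tofrac_eq0 polyX_eq0. Qed.

Lemma tofrac_affine a b : tofrac (affine a b) = tfC a * tfs R + tfC b.
Proof. by rewrite /affine tofracD tofracM. Qed.

(** Here [kb] stands for 1/b: the term -1/b in [kd] compensates the line, and the rest factors. An
    abstract field lets [field] treat s as a variable. *)
Lemma vsi_loop_field {F : fieldType} {s kb t r c : F} : s != 0 -> c != 0 ->
  kb * s + ((t + r) / c + 1 / c / s + (t * r / c - kb) * s) =
  (t * s + 1) * (r * s + 1) / (c * s).
Proof. by move=> s0 c0; field; rewrite s0 c0. Qed.

Lemma vsi_loopE {tau rho c b} : c != 0 ->
  tfC (1 / b) * tfs R
    + G_vsi ((tau + rho) / c) (1 / c) (tau * rho / c - 1 / b) =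
  tofrac (affine tau 1 * affine rho 1) / tofrac (affine c 0).
Proof.
move=> c0; have fc0 : tfC c != 0 by rewrite tfC_eq0.
rewrite /G_vsi tofracM !tofrac_affine.
rewrite (tfCD (_ / _)) (tfCN (1 / b)) (tfCM (tau + rho)) (tfCM 1 c^-1).
rewrite (tfCM (_ * _)) (tfCM tau) (tfCD tau) (tfCV c) tfC1.
have -> : tfC 0 = 0 :> tf R by rewrite /tfC tofrac0.
by rewrite addr0 (vsi_loop_field tfs_neq0 fc0).
Qed.

Lemma G_vsiE kp ki kd : G_vsi kp ki kd =
  tofrac (affine kd kp * 'X + ki%:P) / tofrac 'X.
Proof.
rewrite /G_vsi tofracD tofracM tofrac_affine -/(tfs R) -/(tfC ki).
rewrite mulrDl (mulfK tfs_neq0).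
by rewrite addrC addrA.
Qed.

Lemma G_pvsiE {tau rho c b} : c != 0 ->
  G_pvsi b (G_vsi ((tau + rho) / c) (1 / c) (tau * rho / c - 1 / b)) =
  tofrac (- affine c 0) / tofrac (affine tau 1 * affine rho 1).
Proof.
move=> c0; rewrite /G_pvsi (vsi_loopE c0).
by rewrite div1r invf_div tofracN mulNr.
Qed.

Lemma closed_loop_field (F : fieldType) (s h al ag t r : F) :
    s != 0 -> ag * (t - r) != 0 -> t * s + 1 != 0 -> r * s + 1 != 0 ->
    (h * s + al) * (t * s + 1) + ag != 0 ->
    (h * s + al) * (r * s + 1) + ag != 0 ->
  let f := (t * s + 1) * (r * s + 1) / (ag * (t - r) * s) in
  let g := 1 / (h * s + al + ag / (t * s + 1)) in
  f * g / (f + g) = (r * s + 1) / ((h * s + al) * (r * s + 1) + ag).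
Proof.
move=> s0; rewrite mulf_eq0 negb_or => /andP[ag0 tr0] t0 r0 dt0 dr0 /=.
have -> : 1 / (h * s + al + ag / (t * s + 1)) =
    (t * s + 1) / ((h * s + al) * (t * s + 1) + ag).
  by field; rewrite dt0 t0.
set d := (h * s + al) * (r * s + 1) + ag in dr0 *.
set e := (h * s + al) * (t * s + 1) + ag in dt0 *.
(* The choice of c enters here: (r s + 1) e + ag (t - r) s = (t s + 1) d. Both factors t s + 1 of
   the sum then cancel against those of the product f g. *)
have -> : (t * s + 1) * (r * s + 1) / (ag * (t - r) * s) + (t * s + 1) / e
    = (t * s + 1) * (t * s + 1) * d / (ag * (t - r) * s * e).
  rewrite /e in dt0 *; rewrite /d; field.
  by rewrite dt0 s0 tr0.
by field; rewrite s0 ag0 tr0 t0 dr0 dt0.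
Qed.

Lemma G_clE H al ag tau rho b : 0 < al -> 0 < ag -> rho < tau ->
  let c := ag * (tau - rho) in
  - G_cl b (G_sm H al ag tau)
      (G_vsi ((tau + rho) / c) (1 / c) (tau * rho / c - 1 / b)) =
  tofrac (affine rho 1) / tofrac (affine (2 * H) al * affine rho 1 + ag%:P).
Proof.
move=> al0 ag0 rt c.
have c0 : c != 0 by rewrite mulf_neq0 ?gt_eqF ?subr_gt0.
(* The value at 0 is [al + ag]. Both [x = tau] (machine) and [x = rho] (closed loop) occur. *)
have den0 x : affine (2 * H) al * affine x 1 + ag%:P != 0.
  have : al + ag != 0 by rewrite gt_eqF ?addr_gt0.
  apply: contraNneq => /(congr1 (horner^~ 0)).
  by rewrite /affine !hornerE => ->.
(* [addrAC] puts line and inverter side by side in the denominator. *)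
rewrite /G_cl opprK addrAC (vsi_loopE c0) /G_sm.
rewrite (tofracM (affine _ _)) (tofracD (affine _ _ * _)).
rewrite (tofracM (affine (2 * H) al)) !tofrac_affine tfC1.
have -> : tfC 0 = 0 :> tf R by rewrite /tfC tofrac0.
rewrite addr0 /c (tfCM ag) (tfCD tau) (tfCN rho).
apply: closed_loop_field.
- exact: tfs_neq0.
- by rewrite -(tfCN rho) -(tfCD tau) -(tfCM ag) tfC_eq0.
- by rewrite -tfC1 -tofrac_affine tofrac_eq0 affine_neq0 ?oner_neq0.
- by rewrite -tfC1 -tofrac_affine tofrac_eq0 affine_neq0 ?oner_neq0.
- by rewrite -tfC1 -!tofrac_affine -tofracM -tofracD tofrac_eq0.
- by rewrite -tfC1 -!tofrac_affine -tofracM -tofracD tofrac_eq0.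
Qed.

(** * Location of roots, and positive realness *)

Lemma root_affine_Re_lt0 {a z} : 0 <= a ->
  root (to_complex (affine a 1)) z -> complex.Re z < 0.
Proof.
move=> a0 /rootP; rewrite to_complex_affine => az.
rewrite ltNge; apply/negP => z0.
by have := Re_affine_gt0 a0 ltr01 z0; rewrite az ltxx.
Qed.

Lemma quadratic_Re_lt0 kd kp ki z : 0 <= kd -> 0 < kp -> 0 < ki ->
  root (to_complex (affine kd kp * 'X + ki%:P)) z -> complex.Re z < 0.
Proof.
move=> kd0 kp0 ki0 /rootP.
have -> : (to_complex (affine kd kp * 'X + ki%:P)).[z] =
    (kd%:C%C * z + kp%:C%C) * z + ki%:C%C.
  rewrite -to_complex_affine /to_complex rmorphD rmorphM /= !map_polyC.
  by rewrite map_polyX !hornerE.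
(* For z != 0, dividing by z gives kd z + kp + ki / z = 0, whose left-hand side
   has real part at least kp when Re z >= 0. *)
have [->|z0] := eqVneq z 0.
  by rewrite mulr0 add0r => -[/eqP]; rewrite gt_eqF.
move=> e; rewrite ltNge; apply/negP => Rez.
have : complex.Re (kd%:C%C * z + kp%:C%C + ki%:C%C * z^-1) = 0.
  suff -> : kd%:C%C * z + kp%:C%C + ki%:C%C * z^-1 = 0 by [].
  by apply: (mulIf z0); rewrite mul0r mulrDl (mulfVK z0).
apply/eqP; rewrite ReD ReMl gt_eqF // ltr_wpDr ?Re_affine_gt0 //.
by rewrite mulr_ge0 ?ReV_ge0 // ltW.
Qed.

(** The product ki/kd of the roots is negative, so they are real with opposite signs. The witness is
    the root of the quadratic formula with the minus sign. *)
Lemma quadratic_pos_root {kd kp ki} : kd < 0 -> 0 < kp -> 0 < ki ->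
  exists2 x, 0 < x & root (affine kd kp * 'X + ki%:P) x.
Proof.
move=> kd0 kp0 ki0; pose d := kp ^+ 2 - 4 * kd * ki.
have d0 : 0 <= d by rewrite /d; nra.
have sd : Num.sqrt d ^+ 2 = d by exact: sqr_sqrtr.
exists ((kp + Num.sqrt d) / (- (2 * kd))).
  by rewrite divr_gt0 ?ltr_pwDl ?sqrtr_ge0 // oppr_gt0 pmulr_rlt0.
have kdn : kd != 0 by rewrite lt_eqF.
apply/rootP; rewrite /affine !(hornerD, hornerM, hornerX, hornerC).
move: (Num.sqrt d) sd => r sd.
(* Completing the square: kd x^2 + kp x + ki = ((2 kd x + kp)^2 - d) / (4 kd), with 2 kd x + kp =
   -r. *)
rewrite [LHS](_ : _ = (r ^+ 2 - d) / (4 * kd)); last by rewrite /d; field.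
by rewrite sd subrr mul0r.
Qed.

Lemma passive_machine {H al ag rho} {G : tf R} :
  0 < H -> 0 < al -> 0 < ag -> 0 <= rho ->
  G = tofrac (affine rho 1)
      / tofrac (affine (2 * H) al * affine rho 1 + ag%:P) -> passive G.
Proof.
move=> H0 al0 ag0 rho0 GE z /ltW z0.
set den := affine (2 * H) al * _ + _ in GE.
(* [w] is the denominator of the turbine lag and [u] is the inverse of G at z. Both have positive
   real part, so [den], whose value is [u * w], does not vanish at z. *)
set w := rho%:C%C * z + (1 : R)%:C%C.
set u := (2 * H)%:C%C * z + al%:C%C + ag%:C%C * w^-1.
have w0 : 0 < complex.Re w by exact: Re_affine_gt0.
have wn0 : w != 0 by rewrite Re_neq0 // gt_eqF.
have u0 : 0 < complex.Re u.
  rewrite ReD ltr_pwDl ?Re_affine_gt0 ?mulr_ge0 //; first lra.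
  by rewrite ReMl mulr_ge0 ?ReV_ge0 // ltW.
have un0 : u != 0 by rewrite Re_neq0 // gt_eqF.
have denE : (to_complex den).[z] = u * w.
  rewrite /to_complex /den rmorphD rmorphM /= map_polyC hornerD hornerM hornerC.
  by rewrite !to_complex_affine -/w /u [RHS]mulrDl (mulfVK wn0).
have denz : (to_complex den).[z] != 0 by rewrite denE mulf_neq0.
have den0 : den != 0.
  by apply: contraNneq denz => ->; rewrite /to_complex rmorph0 horner0.
have npole : ~ is_pole G z.
  by move=> /(is_pole_root den0 GE) /rootP /eqP; rewrite (negPf denz).
split=> //; first exact: tfeval_derivable.
rewrite (tfevalE den0 GE denz) denE to_complex_affine -/w.
by rewrite invfM mulrCA (mulfV wn0) mulr1 ReV_ge0 // ltW.
Qed.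

Lemma minimum_phase_vsi {kp ki} kd : 0 < kp -> 0 < ki ->
  minimum_phase (- G_vsi kp ki kd) <-> 0 <= kd.
Proof.
move=> kp0 ki0; set p := affine kd kp * 'X + ki%:P.
have GE : - G_vsi kp ki kd = tofrac (- p) / tofrac 'X.
  by rewrite G_vsiE tofracN mulNr.
have X0 : 'X != 0 :> {poly R} by rewrite polyX_eq0.
have rootN z : root (to_complex (- p)) z = root (to_complex p) z.
  by rewrite /to_complex rmorphN rootN.
split=> [mp|kd0 z /(is_zero_root X0 GE)]; last first.
  by rewrite rootN; exact: quadratic_Re_lt0.
rewrite leNgt; apply/negP => kd0.
have [x x0 px] := quadratic_pos_root kd0 kp0 ki0.
(* The value of [p] at 0 is [ki], which is nonzero, so the positive root does not cancel. *)
have cop : coprimep (- p) 'X.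
  rewrite coprimepX rootE hornerN /p /affine.
  by rewrite !hornerE oppr_eq0 gt_eqF.
suff /mp /= : is_zero (- G_vsi kp ki kd) x%:C%C by rewrite ltNge (ltW x0).
apply: (root_is_zero X0 cop GE); rewrite rootN.
by apply/rootP; rewrite /to_complex horner_map /= (rootP px).
Qed.

End PowerSystem.

Theorem proposition1 (R : realType)
    (H alpha_l alpha_g tau b bhat rho kd kp ki : R)
    (H_gt0 : 0 < H) (alpha_l_gt0 : 0 < alpha_l) (alpha_g_gt0 : 0 < alpha_g)
    (tau_gt0 : 0 < tau) (b_gt0 : 0 < b)
    (rhoU : setU_rho tau rho)
    (bhatE : bhat = b)
    (kdE : kd = tau * rho / (alpha_g * (tau - rho)) - 1 / bhat)
    (kpE : kp = (tau + rho) / (alpha_g * (tau - rho)))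
    (kiE : ki = 1 / (alpha_g * (tau - rho))) :
  [/\ stable (G_pvsi b (G_vsi kp ki kd)),
      passive (- G_cl b (G_sm H alpha_l alpha_g tau) (G_vsi kp ki kd))
    & minimum_phase (- G_vsi kp ki kd) <-> setN_rho alpha_g tau bhat rho].
Proof.
move: rhoU => /andP[rho0 rho_tau].
have c0 : 0 < alpha_g * (tau - rho) by rewrite mulr_gt0 ?subr_gt0.
have kp0 : 0 < kp by rewrite kpE divr_gt0 // ltr_pwDl.
have ki0 : 0 < ki by rewrite kiE divr_gt0.
(* Clearing positive denominators turns both sides into alpha_g (tau - rho) <= tau rho b, up to
   rearrangement. *)
have kd_ge0 : (0 <= kd) = (alpha_g * tau / (bhat * tau + alpha_g) <= rho).
  have bt0 : 0 < bhat * tau + alpha_g by rewrite bhatE addr_gt0 ?mulr_gt0.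
  rewrite kdE bhatE subr_ge0 ler_pdivrMr // mulrAC ler_pdivlMr // mul1r.
  rewrite -bhatE ler_pdivrMr //.
  by apply/idP/idP => h; lra.
split; last first.
- rewrite (minimum_phase_vsi _ kp0 ki0) kd_ge0 /setN_rho /=.
  by rewrite rho_tau andbT.
- rewrite kdE kpE kiE bhatE.
  apply: (passive_machine H_gt0 alpha_l_gt0 alpha_g_gt0 rho0).
  exact: G_clE.
move=> z; rewrite kdE kpE kiE bhatE.
have q0 : affine tau 1 * affine rho 1 != 0.
  by rewrite mulf_neq0 ?affine_neq0 ?oner_neq0.
move=> /(is_pole_root q0 (G_pvsiE (lt0r_neq0 c0))).
rewrite /to_complex rmorphM rootM => /orP[]; apply: root_affine_Re_lt0 => //.
exact: ltW.
Qed.
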